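(* Fix a real number $t>0$ and an integer $n\ge 4$. For $1\le d\le n-1$ let $$g_{U_{n,d}}(t)=\sum_{i=1}^{\min(d,n-d)} \frac{(n-i-1)!}{(d-i)!\,(n-d-i)!\,(i-1)!}\, t^i .$$ Then the finite sequence $\{g_{U_{n,d}}(t)\}_{d=1}^{n-1}$ is infinitely log-concave.
   Context: $g_{U_{n,d}}(t)$ is Speyer's $g$-polynomial of the uniform matroid $U_{n,d}$ of rank $d$ on $n$ elements, given by the displayed formula. For a real sequence $\{a_k\}$ (a finite sequence being extended by zeros outside its index range), define the operator $\mathfrak{L}$ by $\mathfrak{L}(\{a_k\})=\{b_k\}$ with $b_k=a_k^2-a_{k-1}a_{k+1}$. The sequence is called infinitely log-concave if $\mathfrak{L}^j(\{a_k\})$ is a nonnegative sequence for every $j\ge 1$. *)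

(* Defs.v *)
From mathcomp Require Import all_boot all_order all_algebra.
From mathcomp Require Import reals.

Set Implicit Arguments.
Unset Strict Implicit.
Unset Printing Implicit Defensive.

Import Order.TTheory GRing.Theory Num.Theory.
Local Open Scope ring_scope.

(* Speyer's g-polynomial of U_{n,d}, evaluated at t. In the range of the sum,
   i <= d and i <= n - d, so none of the natural subtractions truncates as long
   as 1 <= d <= n - 1. *)
Definition gU (R : realType) (n d : nat) (t : R) : R :=
  \sum_(1 <= i < (minn d (n - d)).+1)
     ((n - i - 1)`!%:R / ((d - i)`!%:R * (n - d - i)`!%:R * (i - 1)`!%:R))
     * t ^+ i.

(* Sequences are indexed by all of Z, so that the terms a_{k-1} and a_{k+1} make
   sense for every k; a finite sequence a_m, ..., a_p is extended by zeros. *)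
Definition zero_ext (R : realType) (m p : nat) (a : nat -> R) : int -> R :=
  fun k => if k is Posz d then if (m <= d <= p)%N then a d else 0 else 0.

Definition logconc_op (R : realType) (a : int -> R) : int -> R :=
  fun k => a k ^+ 2 - a (k - 1) * a (k + 1).

Definition infinitely_log_concave (R : realType) (a : int -> R) : Prop :=
  forall j : nat, (1 <= j)%N ->
  forall k : int, 0 <= iter j (@logconc_op R) a k.

(* Main.v *)
(* Up to the factor t X, the generating polynomial of the sequence is Q_(n-2),
   where Q_(m+2) = (1 + X) Q_(m+1) + t X Q_m.  Off the negative axis write
   x = y^2 with Re y > 0: the recurrence shows by induction that
   Re (Q_(m+1)(x) / (y Q_m(x))) > 0, so Q_m has only negative roots.
   It remains to see (Brändén) that the operator preserves polynomials with
   positive constant term and only negative roots.  If p = prod (1 + x_i X),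
   then sum_k (p_k^2 - p_(k-1) p_(k+1)) y^(2k) is, up to a nonzero factor, the
   integral of f = prod (X + a_i) against the semicircle law, where
   a_i = x_i y + 1 / (x_i y) has positive real part.  This integral does not
   vanish: by Grace's theorem it suffices that the integral g_n of (X + w)^n is
   nonzero when w is not imaginary, and this follows from the three-term
   recurrence of g_n, since with s^2 = w^2 - 4 and Im (w / s) > 0 the imaginary
   part of g_(n+1) / (s g_n) stays positive. *)
From HB Require Import structures.
Require Import Defs.
From mathcomp Require Import all_boot all_order all_algebra.
From mathcomp Require Import reals complex zify ring.

Set Implicit Arguments.
Unset Strict Implicit.
Unset Printing Implicit Defensive.

Import Order.TTheory GRing.Theory Num.Theory.
Local Open Scope ring_scope.

Section NegativeRoots.
Variable C : numClosedFieldType.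
Implicit Types (x y z w a b : C) (f p q : {poly C}) (rs : seq C).

(** * Complex numbers with positive real part *)

Lemma Re_gt0_neq0 z : 0 < 'Re z -> z != 0.
Proof. by apply: contraTneq => ->; rewrite raddf0 ltxx. Qed.

Lemma Re_inv_gt0 z : 0 < 'Re z -> 0 < 'Re z^-1.
Proof.
move=> z_gt0; rewrite ReV divr_gt0 // exprn_gt0 // normr_gt0.
exact: Re_gt0_neq0.
Qed.

(** A purely imaginary root would make x a nonpositive real, so one of the two opposite roots lies
    in the open right half-plane. *)
Lemma sqrt_Re_gt0 x : ~~ (x <= 0) -> exists2 y, y ^+ 2 = x & 0 < 'Re y.
Proof.
move=> x_nle0; set y := sqrtC x; have yE : y ^+ 2 = x by exact: sqrtCK.
have Rey_neq0 : 'Re y != 0.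
  apply: contraNneq x_nle0 => Rey0.
  rewrite -yE [y]Crect Rey0 add0r exprMn sqrCi mulN1r oppr_le0.
  by rewrite real_exprn_even_ge0 ?Creal_Im.
have [yp|yn|/esym/eqP] := real_ltgtP (real0 C) (Creal_Re y).
- by exists y.
- by exists (- y); rewrite ?sqrrN // raddfN oppr_gt0.
- by rewrite (negPf Rey_neq0).
Qed.

(** The product equals minus the inverse of 1/a + 1/(-b), and inversion preserves the right
    half-plane. Laguerre's theorem applies this to each root. *)
Lemma Re_harmonic_lt0 a b :
  0 <= 'Re a -> a != 0 -> 'Re b < 0 -> 'Re (a * (b / (a - b))) < 0.
Proof.
move=> a_ge0 a_neq0 b_lt0.
have nb_gt0 : 0 < 'Re (- b) by rewrite raddfN oppr_gt0.
have b_neq0 : b != 0 by rewrite -oppr_eq0 Re_gt0_neq0.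
have ab_neq0 : a - b != 0 by rewrite Re_gt0_neq0 // raddfD /= ltr_wpDl.
have -> : a * (b / (a - b)) = - (a^-1 + (- b)^-1)^-1.
  rewrite invrN; have -> : a^-1 - b^-1 = - ((a - b) / (a * b)).
    by field; rewrite b_neq0 a_neq0.
  by rewrite invrN opprK invf_div; field; rewrite ab_neq0.
rewrite raddfN oppr_lt0 Re_inv_gt0 // raddfD /= ltr_wpDl ?Re_inv_gt0 //.
by rewrite ReV mulr_ge0 // invr_ge0 exprn_ge0.
Qed.

(** * Polar derivatives and Laguerre's theorem *)

Lemma deriv_prod_XsubC rs z : z \notin rs ->
  (\prod_(r <- rs) ('X - r%:P))^`().[z] =
  (\prod_(r <- rs) ('X - r%:P)).[z] * \sum_(r <- rs) (z - r)^-1.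
Proof.
elim: rs => [|r rs IH]; first by rewrite !big_nil derivC horner0 mulr0.
rewrite inE negb_or => /andP[z_neq_r /IH IHz].
rewrite !big_cons derivM hornerD !hornerM IHz derivXsubC hornerXsubC.
by rewrite -polyC1 hornerC; field; rewrite subr_eq0.
Qed.

(** The classical polar derivative with pole z, where n is the formal degree of f. *)
Definition polar (z : C) (n : nat) f := (z%:P - 'X) * f^`() + f *+ n.

Fact polar_is_linear z n : linear (polar z n).
Proof.
move=> a p q; rewrite /polar linearP /= mulrDr mulrnDl -scalerAr scalerMnr scalerDr.
by rewrite addrACA.
Qed.

Lemma coef_polar z n f i :
  (polar z n f)`_i = z * f`_i.+1 *+ i.+1 + (f`_i *+ n - f`_i *+ i).
Proof.
rewrite /polar mulrBl coefD coefB coefCM coefXM coefMn !coef_deriv.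
rewrite mulrnAr -addrA; congr (_ + _).
by case: i => [|i] /=; rewrite 1?addrC ?mulr0n ?oppr0 ?addr0.
Qed.

Lemma polar_XaddC_exp z w n :
  polar z n.+1 (('X + w%:P) ^+ n.+1) = ((z + w) *+ n.+1) *: ('X + w%:P) ^+ n.
Proof.
rewrite /polar deriv_exp derivD derivX derivC addr0 mul1r /=.
rewrite exprS mulrnAr -mulrnDl -mulrDl -scalerMnl; congr (_ *+ _).
by rewrite -mul_polyC polyCD; ring.
Qed.

(* Laguerre's theorem for the left half-plane and a pole on its boundary. *)
Lemma polar_hurwitz z n f : 'Re z = 0 -> size f = n.+2 ->
    (forall x, root f x -> 'Re x < 0) ->
  size (polar z n.+1 f) = n.+1 /\
  (forall x, root (polar z n.+1 f) x -> 'Re x < 0).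
Proof.
move=> Rez0 size_f Hf; have [rs fE] := closed_field_poly_normal f.
have f_neq0 : f != 0 by rewrite -size_poly_gt0 size_f.
have c_neq0 : lead_coef f != 0 by rewrite lead_coef_eq0.
have size_rs : size rs = n.+1.
  by move: size_f; rewrite fE size_scale // size_prod_XsubC => -[].
have rs_lt0 r : r \in rs -> 'Re r < 0.
  by move=> r_rs; apply: Hf; rewrite fE rootZ // root_prod_XsubC.
split.
  (* This coefficient is the leading coefficient of f times (n+1) z minus the sum of the roots, a
     number of positive real part. *)
  have lead_neq0 : (polar z n.+1 f)`_n != 0.
    rewrite coef_polar [f`_n *+ _]mulrS addrK fE !coefZ.
    have -> : (\prod_(r <- rs) ('X - r%:P))`_n.+1 = 1.
      by have := lead_coef_prod_XsubC rs xpredT id;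
         rewrite /lead_coef size_prod_XsubC size_rs.
    have -> : (\prod_(r <- rs) ('X - r%:P))`_n = - \sum_(r <- rs) r.
      by rewrite -[n]/(n.+1.-1) -size_rs coefPn_prod_XsubC ?size_rs.
    rewrite mulr1 mulrC -mulrnAr -mulrDr mulf_neq0 //.
    apply: Re_gt0_neq0; rewrite raddfB /= raddfMn /= Rez0 mul0rn sub0r.
    rewrite oppr_gt0 raddf_sum /=.
    case: rs size_rs rs_lt0 {fE} => // r rs _ rs_lt0.
    rewrite big_cons ltr_nwDl ?rs_lt0 ?mem_head //.
    rewrite big_seq sumr_le0 // => i i_rs.
    by rewrite ltW // rs_lt0 // in_cons i_rs orbT.
  apply/eqP; rewrite eqn_leq; apply/andP; split; last first.
    by rewrite ltnNge; apply: contra lead_neq0 => /leq_sizeP ->.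
  apply/leq_sizeP => i le_ni; rewrite coef_polar.
  rewrite [f`_i.+1]nth_default ?size_f // mulr0 mul0rn add0r.
  (* In degree n+1 the two remaining contributions cancel. *)
  move: le_ni; rewrite leq_eqVlt => /predU1P[<-|lt_ni]; first by rewrite subrr.
  by rewrite nth_default ?size_f // !mul0rn subrr.
move=> x; rewrite /root => /eqP px0; apply: contraTT isT => Rex.
have {}Rex : 0 <= 'Re x.
  by rewrite real_leNgt ?real0 ?Creal_Re.
have x_rs : x \notin rs.
  by apply: contraL Rex => /rs_lt0; rewrite real_ltNge ?real0 ?Creal_Re.
have fx_neq0 : (\prod_(r <- rs) ('X - r%:P)).[x] != 0.
  by have := root_prod_XsubC rs x; rewrite (negPf x_rs) /root => ->.
(* At the pole the polar derivative takes the value (n+1) f(z), which would not vanish. *)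
have x_neq_z : x - z != 0.
  apply/eqP => /subr0_eq xz; move/eqP: px0; rewrite /polar fE xz.
  rewrite !hornerE subrr mul0r add0r hornerMn hornerZ -xz mulrn_eq0 /=.
  by rewrite mulf_eq0 (negPf c_neq0) (negPf fx_neq0).
(* Dividing the equation at x by f(x) gives a zero sum of (x-z)/(x-r) - 1 = (r-z)/(x-r). The extra
   factor x - z gives each term the shape of [Re_harmonic_lt0]. *)
have sum0 : \sum_(r <- rs) (x - z) * ((r - z) / ((x - z) - (r - z))) = 0.
  have : \sum_(r <- rs) ((x - z) * (x - r)^-1 - 1) = 0.
    rewrite sumrB -mulr_sumr big_const_seq count_predT size_rs iter_addr_0.
    move/eqP: px0; rewrite /polar fE hornerD hornerM hornerMn derivZ !hornerZ.
    rewrite deriv_prod_XsubC // hornerD hornerN hornerC hornerX.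
    set P := _.[x]; set S := \sum_(r <- rs) _ => eq0; apply/eqP.
    have: (lead_coef f * P) * ((x - z) * S - n.+1%:R) == 0.
      by rewrite -oppr_eq0 -(eqP eq0); apply/eqP; rewrite -[in RHS]mulr_natr; ring.
    by rewrite mulf_eq0 mulf_eq0 (negPf c_neq0) (negPf fx_neq0).
  move=> sum0; rewrite -mulr_sumr; apply/eqP; rewrite mulf_eq0 (negPf x_neq_z) /=.
  apply/eqP; rewrite -[RHS]sum0 !big_seq; apply: eq_bigr => r r_rs.
  have xr : x - r != 0 by rewrite subr_eq0; apply: contraNneq x_rs => ->.
  have -> : x - z - (r - z) = x - r by ring.
  by field.
have : 'Re (\sum_(r <- rs) (x - z) * ((r - z) / ((x - z) - (r - z)))) < 0.
  have term_lt0 r : r \in rs -> 'Re ((x - z) * ((r - z) / ((x - z) - (r - z)))) < 0.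
    move=> /rs_lt0 r_lt0; apply: Re_harmonic_lt0 => //.
      by rewrite raddfB /= Rez0 subr0.
    by rewrite raddfB /= Rez0 subr0.
  rewrite raddf_sum /=.
  case: rs size_rs term_lt0 {fE rs_lt0 x_rs fx_neq0 sum0} => // r rs _ term_lt0.
  rewrite big_cons ltr_nwDl ?term_lt0 ?mem_head //.
  rewrite big_seq sumr_le0 // => i i_rs.
  by rewrite ltW // term_lt0 // in_cons i_rs orbT.
by rewrite sum0 raddf0 ltxx.
Qed.

(** * Grace's theorem for linear functionals on polynomials *)

Definition power_poly (L : {scalar {poly C}}) n : {poly C} :=
  \poly_(i < n.+1) (L 'X^(n - i) *+ 'C(n, i)).

Lemma horner_power_poly (L : {scalar {poly C}}) n w :
  (power_poly L n).[w] = L (('X + w%:P) ^+ n).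
Proof.
rewrite exprDn linear_sum horner_poly; apply: eq_bigr => i _.
rewrite linearMn -polyC_exp [_ * _%:P]mulrC mul_polyC linearZ /=.
by rewrite mulrnAl mulrC.
Qed.

Lemma poly_all_roots p : (forall w, p.[w] = 0) -> p = 0.
Proof.
move=> p0; apply/eqP/negPn/negP => /max_poly_roots.
move=> /(_ [seq i%:R | i <- iota 0 (size p)]).
rewrite size_map size_iota ltnn => H; suff : false by []; apply: H.
  by apply/allP => x _; rewrite /root p0.
by rewrite map_inj_uniq ?iota_uniq // => i j /eqP; rewrite eqr_nat => /eqP.
Qed.

(** The coefficients of [power_poly L n] are the values of L on monomials up to nonzero binomials,
    so the powers determine L up to degree n. *)
Lemma eq_scalar_powers (L M : {scalar {poly C}}) n :
    (forall w, L (('X + w%:P) ^+ n) = M (('X + w%:P) ^+ n)) ->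
  forall f, (size f <= n.+1)%N -> L f = M f.
Proof.
move=> LM f size_f.
have eqW : power_poly L n = power_poly M n.
  apply/eqP; rewrite -subr_eq0; apply/eqP/poly_all_roots => w.
  by rewrite hornerD hornerN !horner_power_poly LM subrr.
have eqX k : (k <= n)%N -> L 'X^k = M 'X^k.
  move=> le_kn; have /(congr1 (fun p : {poly C} => p`_(n - k))) := eqW.
  rewrite !coef_poly ltnS leq_subr subKn // => /eqP.
  rewrite -subr_eq0 -mulrnBl mulrn_eq0 subr_eq0 => /orP[|/eqP //].
  by rewrite eqn0Ngt bin_gt0 leq_subr.
rewrite -(coefK f) poly_def !linear_sum; apply: eq_bigr => i _.
by rewrite !linearZ /= eqX // -ltnS (leq_trans (ltn_ord i)).
Qed.

(** The formal degree is the number of poles left, so a polynomial of degree [size zs] ends as a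
    constant. *)
Fixpoint polars (zs : seq C) f : {poly C} :=
  if zs is z :: zs' then polars zs' (polar z (size zs) f) else f.

Fact polars_is_linear zs : linear (polars zs).
Proof.
elim: zs => [|z zs IH] a p q //.
by rewrite [LHS]/= polar_is_linear IH.
Qed.

Lemma polars_XaddC_exp zs w :
  polars zs (('X + w%:P) ^+ size zs) =
  ((\prod_(z <- zs) (z + w)) *+ (size zs)`!)%:P.
Proof.
elim: zs => [|z zs IH]; first by rewrite big_nil.
rewrite [LHS]/= polar_XaddC_exp -[_ *: _]addr0 polars_is_linear.
have -> : polars zs 0 = 0.
  by have := polars_is_linear zs (-1) 0 0; rewrite scaler0 addr0 scaleN1r addNr.
rewrite addr0 IH big_cons -mul_polyC -polyCM factS mulnC.
by rewrite mulrnAl mulrnAr -mulrnA.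
Qed.

(** By Laguerre's theorem each step lowers the degree by exactly one and keeps the roots in the left
    half-plane; a nonzero constant remains. *)
Lemma polars_hurwitz zs f : (forall z, z \in zs -> 'Re z = 0) ->
    size f = (size zs).+1 -> (forall x, root f x -> 'Re x < 0) ->
  (polars zs f)`_0 != 0.
Proof.
elim: zs f => [|z zs IH] f zs0 size_f Hf /=.
  have := size_f => /eqP/size_poly1P[c c_neq0 ->].
  by rewrite coefC.
have [size_pf Hpf] := polar_hurwitz (zs0 _ (mem_head _ _)) size_f Hf.
by apply: IH => // x x_zs; apply: zs0; rewrite in_cons x_zs orbT.
Qed.

(* Grace's theorem: the roots z of [power_poly L n] turn L into a multiple of
   the composition of the polar derivatives with poles - z. *)
Lemma grace_hurwitz (L : {scalar {poly C}}) n f : L 1 != 0 ->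
    (forall w, 'Re w != 0 -> L (('X + w%:P) ^+ n) != 0) ->
    size f = n.+1 -> (forall x, root f x -> 'Re x < 0) ->
  L f != 0.
Proof.
move=> L1 HL size_f Hf.
have [rs WE] := closed_field_poly_normal (power_poly L n).
have lcE : lead_coef (power_poly L n) = L 1.
  by rewrite lead_coef_poly // ?subnn ?binn.
rewrite {}lcE in WE.
have size_rs : size rs = n.
  have : size (power_poly L n) = n.+1 by rewrite size_poly_eq // subnn binn.
  by rewrite WE size_scale // size_prod_XsubC => -[].
pose zs := [seq - r | r <- rs].
have size_zs : size zs = n by rewrite size_map.
have zs0 z : z \in zs -> 'Re z = 0.
  case/mapP => r r_rs ->; apply/eqP; apply: contraTT r_rs.
  rewrite raddfN oppr_eq0 => /HL; rewrite -horner_power_poly WE hornerZ.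
  rewrite mulf_eq0 (negPf L1) /= -[_ == 0]/(root _ _).
  by rewrite root_prod_XsubC.
(* The scalar matches the two values on (X + w)^n, which are L(1) times the product of the w - r,
   and n! times the same product. *)
pose M0 g := (L 1 / n`!%:R) * (polars zs g)`_0.
have M0_linear : scalar M0.
  by move=> a p q; rewrite /M0 polars_is_linear coefD coefZ; ring.
pose M : {scalar {poly C}} :=
  HB.pack M0 (GRing.isLinear.Build _ _ _ _ M0 M0_linear).
have nfact_neq0 : n`!%:R != 0 :> C by rewrite pnatr_eq0 -lt0n fact_gt0.
have -> : L f = M f.
  apply: (@eq_scalar_powers L M n); last by rewrite size_f.
  move=> w; rewrite -horner_power_poly WE hornerZ horner_prod /M /= /M0.
  rewrite -{2}size_zs polars_XaddC_exp coefC /= size_zs big_map.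
  rewrite mulrnAr -[RHS]mulr_natr mulrAC divfK //; congr (_ * _).
  by apply: eq_bigr => r _; rewrite hornerXsubC addrC.
by rewrite /M /= /M0 mulf_neq0 ?mulf_neq0 ?invr_eq0 // polars_hurwitz ?size_zs.
Qed.

(** * Moments of the semicircle law and integration by parts *)

(* The moments 1, 0, 1, 0, 2, 0, 5, ... of the semicircle law on [-2, 2]. *)
Definition moment k : C :=
  ((1 + 'X^2) ^+ k : {poly C})`_k - ((1 + 'X^2) ^+ k : {poly C})`_k.+2.

Lemma coef_1DX2_exp k i :
  ((1 + 'X^2) ^+ k : {poly C})`_i = if odd i then 0 else 'C(k, i./2)%:R.
Proof.
elim: k i => [|k IH] [|[|i]].
- by rewrite expr0 coef1.
- by rewrite expr0 coef1.
- by rewrite expr0 coef1 /= negbK; case: odd; rewrite ?bin0n.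
- by rewrite exprS mulrDl mul1r coefD coefXnM /= IH /= !bin0 addr0.
- by rewrite exprS mulrDl mul1r coefD coefXnM /= IH /= addr0.
rewrite exprS mulrDl mul1r coefD coefXnM /= !IH /= ?negbK.
by rewrite subSS subSS subn0; case: odd; rewrite ?addr0 // binS natrD.
Qed.

Lemma moment0 : moment 0 = 1.
Proof. by rewrite /moment !coef_1DX2_exp /= bin0n subr0. Qed.

Lemma moment_odd k : odd k -> moment k = 0.
Proof. by move=> k_odd; rewrite /moment !coef_1DX2_exp /= k_odd subrr. Qed.

(** For k = 2j this is the Catalan recurrence (j+2) C_(j+1) = 2 (2j+1) C_j, up to a factor 2. It is
    integration by parts for the monomial of degree k+1. *)
Lemma moment_rec k : k.+4%:R * moment k.+2 = (4 * k.+1)%:R * moment k.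
Proof.
have [k_odd|k_even] := boolP (odd k).
  by rewrite !moment_odd ?mulr0 //= k_odd.
rewrite /moment !coef_1DX2_exp /= !negbK (negPf k_even).
rewrite -[k in LHS]even_halfK // -[k in RHS]even_halfK //.
move: k./2 => j {k k_even}; rewrite /= !doubleK.
have h1 : (j.+1 * 'C(j.*2, j.+1) = j * 'C(j.*2, j))%N.
  by rewrite mul_bin_left; congr (_ * _)%N; lia.
have h2 : (j.+1 * 'C(j.*2.+2, j.+1) = 2 * (j.*2.+1 * 'C(j.*2, j)))%N.
  rewrite -(mul_bin_diag j.*2.+2 j) (mul_bin_down j.*2.+1 j) /=.
  by rewrite (_ : j.*2.+1 - j = j.+1)%N; lia.
have h3 : (j.+2 * 'C(j.*2.+2, j.+2) = j.+1 * 'C(j.*2.+2, j.+1))%N.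
  by rewrite mul_bin_left; congr (_ * _)%N; lia.
move: h1 h2 h3; set A := 'C(_, j); set A1 := 'C(_, _); set B := 'C(_, _).
set B1 := 'C(_, _) => h1 h2 h3.
have j1 : j.+1%:R != 0 :> C by rewrite pnatr_eq0.
have toC (x y : nat) : x = y -> x%:R = y%:R :> C by move=> ->.
apply: (mulfI j1).
move/toC: h1; move/toC: h2; move/toC: h3; rewrite !natrM => h3 h2 h1.
rewrite -[j.*2.+4]/(j.+2.*2) -muln2 !natrM !mulrBr.
have -> : j.+1%:R * (j.+2%:R * 2 * B1%:R) = j.+1%:R * (j.+1%:R * B%:R) * 2 :> C.
  by rewrite -h3; ring.
have -> : j.+1%:R * (4 * j.*2.+1%:R * A1%:R) = 4 * j.*2.+1%:R * (j%:R * A%:R) :> C.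
  by rewrite -h1; ring.
have -> : j.+1%:R * (j.+2%:R * 2 * B%:R) = j.+2%:R * 2 * (2 * (j.*2.+1%:R * A%:R)) :> C.
  by rewrite -h2; ring.
by rewrite h2; ring.
Qed.

Lemma moment_ge0 k : 0 <= moment k.
Proof.
suff : 0 <= moment k /\ 0 <= moment k.+1 by case.
elim: k => [|k [IH1 IH2]]; first by rewrite moment0 moment_odd.
split=> //; have := mulr_ge0 (ler0n C (4 * k.+1)) IH1.
by rewrite -moment_rec pmulr_rge0 // ltr0n.
Qed.

(* Integration of polynomials of degree at most N against the semicircle law. *)
Definition semicircle N (p : {poly C}) : C := \sum_(k < N.+1) p`_k * moment k.

Fact semicircle_is_linear N : scalar (semicircle N).
Proof.
move=> a p q; rewrite /semicircle mulr_sumr -big_split /=.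
by apply: eq_bigr => k _; rewrite coefD coefZ mulrDl mulrA.
Qed.
HB.instance Definition _ N :=
  GRing.isLinear.Build C {poly C} C *%R (semicircle N) (semicircle_is_linear N).

Lemma semicircleXn N k : (k <= N)%N -> semicircle N 'X^k = moment k.
Proof.
rewrite -ltnS => le_kN; rewrite /semicircle (bigD1 (Ordinal le_kN)) //=.
rewrite coefXn eqxx mul1r big1 ?addr0 // => i /negPf neq_ik.
by rewrite coefXn -[_ == k]/(i == Ordinal le_kN) neq_ik mul0r.
Qed.

Lemma semicircle1 N : semicircle N 1 = 1.
Proof. by rewrite -(expr0 'X) semicircleXn // moment0. Qed.

(* The density sqrt (4 - X^2) is killed by (4 - X^2) d/dX + X. *)
Lemma semicircle_by_parts N q : (size q <= N)%N ->
  semicircle N ((4%:P - 'X^2) * q^`() - 3%:P * 'X * q) = 0.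
Proof.
move=> size_q.
have termE k : (k < N)%N ->
    semicircle N ((4%:P - 'X^2) * 'X^k^`() - 3%:P * 'X * 'X^k) = 0.
  move=> lt_kN; rewrite -mulrA -exprS mul_polyC linearB linearZ /=.
  rewrite semicircleXn // derivXn; case: k lt_kN => [|k] lt_kN.
    by rewrite mulr0n mulr0 linear0 moment_odd // mulr0 subr0.
  rewrite mulrnAr linearMn mulrBl mul_polyC -exprD linearB linearZ /=.
  rewrite /= semicircleXn; last by lia.
  rewrite semicircleXn; last by lia.
  rewrite -[_ *+ k.+1]mulr_natl mulrBr mulrA -natrM mulnC -moment_rec.
  by rewrite -[k.+4]addn3; ring.
have -> : (4%:P - 'X^2) * q^`() - 3%:P * 'X * q = \sum_(k < size q)
    q`_k *: ((4%:P - 'X^2) * 'X^k^`() - 3%:P * 'X * 'X^k).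
  rewrite -{1 2}(coefK q) poly_def raddf_sum /= !mulr_sumr -sumrB.
  by apply: eq_bigr => k _; rewrite derivZ scalerBr !scalerAr.
rewrite linear_sum big1 //= => k _.
by rewrite linearZ /= termE ?mulr0 // (leq_trans (ltn_ord k)).
Qed.

(** * Nonvanishing of semicircle integrals *)

Lemma semicircle_powers_rec N n w : (n.+2 <= N)%N ->
  n.+4%:R * semicircle N (('X + w%:P) ^+ n.+2) =
  n.*2.+4.+1%:R * w * semicircle N (('X + w%:P) ^+ n.+1) +
  n.+1%:R * (4 - w ^+ 2) * semicircle N (('X + w%:P) ^+ n).
Proof.
move=> le_nN; set u := 'X + w%:P.
have size_u : size (u ^+ n.+1) = n.+2.
  have -> : u = 'X - (- w)%:P by rewrite polyCN opprK.
  by rewrite size_exp_XsubC.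
have := @semicircle_by_parts N (u ^+ n.+1).
rewrite size_u => /(_ le_nN).
(* Integration by parts is applied to u^(n+1); writing X = u - w leaves only powers of u. *)
have -> : (4%:P - 'X^2) * (u ^+ n.+1)^`() - 3%:P * 'X * u ^+ n.+1 =
  (n.*2.+4.+1%:R * w) *: u ^+ n.+1 + (n.+1%:R * (4 - w ^+ 2)) *: u ^+ n
   - n.+4%:R *: u ^+ n.+2.
  rewrite deriv_exp derivD derivX derivC addr0 mul1r /=.
  have -> : 'X = u - w%:P by rewrite addrK.
  rewrite -!mul_polyC -mulr_natl -[n.*2]muln2 !exprS.
  rewrite !(polyCM, polyCB, polyC_exp) !polyC_natr.
  by move: (u ^+ n) (w%:P) => v c; ring.
by rewrite linearB linearD !linearZ /= => /eqP; rewrite subr_eq0 => /eqP ->.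
Qed.

(** After multiplication by w^N only even moments survive, each with an even power of w, and the top
    term w^(2N) is positive. *)
Lemma semicircle_powers_real N w : w \is Num.real -> w != 0 ->
  semicircle N (('X + w%:P) ^+ N) != 0.
Proof.
move=> w_real w_neq0; suff : 0 < w ^+ N * semicircle N (('X + w%:P) ^+ N).
  by apply: contraTneq => ->; rewrite mulr0 ltxx.
rewrite -horner_power_poly horner_poly mulr_sumr.
rewrite big_ord_recr /= ltr_wpDl //; last first.
  rewrite subnn semicircleXn // moment0 binn mulr1n mul1r -exprD addnn.
  by rewrite lt_def real_exprn_even_ge0 ?odd_double // expf_neq0.
apply: sumr_ge0 => i _; rewrite semicircleXn ?leq_subr // mulrnAl.
rewrite mulrnAr mulrCA -exprD mulrn_wge0 //.
have [odd_k|even_k] := boolP (odd (N - i)).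
  by rewrite moment_odd // mul0r.
rewrite mulr_ge0 ?moment_ge0 // real_exprn_even_ge0 //.
have := ltn_ord i; lia.
Qed.

Lemma semicircle_powers_nonreal N w : 'Im (w ^+ 2) != 0 ->
  semicircle N (('X + w%:P) ^+ N) != 0.
Proof.
move=> Imw2; pose g n := semicircle N (('X + w%:P) ^+ n).
have Im_gt0_neq0 z : 0 < 'Im z -> z != 0.
  by apply: contraTneq => ->; rewrite raddf0 ltxx.
(* The sign of s is free, so only a real w/s has to be excluded: then w^2/(w^2 - 4) would be real,
   and hence w^2 too. *)
have [s sE Im_ws] : exists2 s, s ^+ 2 = w ^+ 2 - 4 & 0 < 'Im (w / s).
  set s := sqrtC (w ^+ 2 - 4); have sE : s ^+ 2 = w ^+ 2 - 4 by exact: sqrtCK.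
  have [Im_gt0|Im_lt0|Im0] := real_ltgtP (real0 C) (Creal_Im (w / s)).
  - by exists s.
  - by exists (- s); rewrite ?sqrrN // invrN mulrN raddfN oppr_gt0.
  have {Im0} : (w / s) ^+ 2 \is Num.real by rewrite rpredX //; apply/Creal_ImP.
  rewrite expr_div_n sE; set r := _ / _ => r_real.
  have s2_neq0 : w ^+ 2 - 4 != 0.
    apply: contraNneq Imw2 => /subr0_eq ->.
    by rewrite (Creal_ImP _ _) // rpred_nat.
  have eq_r : w ^+ 2 * (r - 1) = 4 * r by rewrite /r; field.
  have r1_neq0 : r - 1 != 0.
    rewrite /r; have -> : w ^+ 2 / (w ^+ 2 - 4) - 1 = 4 / (w ^+ 2 - 4) by field.
    by rewrite mulf_neq0 ?invr_eq0 ?pnatr_eq0.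
  case/negP: Imw2; apply/eqP/Creal_ImP.
  rewrite -[w ^+ 2](mulfK r1_neq0) eq_r.
  by apply: realM; [apply: realM => // | rewrite realV realB ?real1].
have s_neq0 : s != 0.
  by apply: contraTneq Im_ws => ->; rewrite invr0 mulr0 raddf0 ltxx.
have step n : (n < N)%N -> g n != 0 /\ 0 < 'Im (g n.+1 / (s * g n)).
  elim: n => [|n IH] lt_nN.
    have g0 : g 0%N = 1 by rewrite /g expr0 semicircle1.
    rewrite g0 oner_neq0 mulr1; split=> //.
    rewrite /g expr1 linearD /= -['X]expr1 semicircleXn // moment_odd // add0r.
    by rewrite -[w%:P]mulr1 mul_polyC linearZ /= semicircle1 mulr1.
  have [gn_neq0 Im_q] := IH (ltnW lt_nN).
  set q := g n.+1 / _ in Im_q; have q_neq0 := Im_gt0_neq0 _ Im_q.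
  have gS_neq0 : g n.+1 != 0.
    by apply: contraTneq q_neq0 => gS0; rewrite /q gS0 mul0r eqxx.
  split=> //.
  (* The recurrence is divided by s g_(n+1), with 4 - w^2 = - s^2. Both w/s and -1/q lie in the
     upper half-plane and have positive weights. *)
  have -> : g n.+2 / (s * g n.+1) =
      n.+4%:R^-1 * (n.*2.+4.+1%:R * (w / s) + n.+1%:R * - q^-1).
    have n4 : n.+4%:R != 0 :> C by rewrite pnatr_eq0.
    apply: (mulfI n4); rewrite mulVKf // [LHS]mulrA /g semicircle_powers_rec //.
    rewrite -/(g n) -/(g n.+1) /q -opprB -sE.
    by field; rewrite s_neq0 gS_neq0 gn_neq0.
  rewrite ImMl ?rpredV ?rpred_nat // mulr_gt0 ?invr_gt0 ?ltr0n //.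
  rewrite raddfD /= !(ImMl (realn _ _)).
  apply: addr_gt0; first by rewrite mulr_gt0 ?ltr0n.
  rewrite mulr_gt0 ?ltr0n // raddfN /= ImV mulNr opprK.
  by rewrite divr_gt0 // exprn_gt0 // normr_gt0.
case: N @g step => [|N] g step; first by rewrite expr0 semicircle1 oner_neq0.
have [_ Im_q] := step N (ltnSn N).
by apply: contraTneq (Im_gt0_neq0 _ Im_q) => gS0; rewrite /g gS0 mul0r eqxx.
Qed.

(** Grace's theorem reduces to powers of X + w with nonzero Re w; there w is a nonzero real, or
    Im(w^2) = 2 Re w Im w is nonzero. *)
Lemma semicircle_hurwitz N f : size f = N.+1 ->
  (forall x, root f x -> 'Re x < 0) -> semicircle N f != 0.
Proof.
apply: grace_hurwitz => [|w Rew]; first by rewrite /= semicircle1 oner_neq0.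
have [/Creal_ImP w_real|Imw] := eqVneq ('Im w) 0.
  apply: semicircle_powers_real => //.
  by apply: contraNneq Rew => ->; rewrite raddf0.
apply: semicircle_powers_nonreal.
by rewrite expr2 ImM -mulr2n mulrn_eq0 mulf_eq0 (negPf Rew) (negPf Imw).
Qed.

(** * Semicircle integrals as coefficients, through the substitution of (1 + X^2)/X for X *)

Definition homogenize N (f : {poly C}) : {poly C} :=
  \sum_(k < N.+1) f`_k *: ('X^(N - k) * (1 + 'X^2) ^+ k).

(** A moment is a difference of two coefficients of (1 + X^2)^k, and X^(N-k) shifts their indices k
    and k+2 to N and N+2 for every k. *)
Lemma semicircle_homogenize N f :
  semicircle N f = (homogenize N f)`_N - (homogenize N f)`_N.+2.
Proof.
rewrite /homogenize !coef_sum -sumrB; apply: eq_bigr => k _.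
rewrite !coefZ -mulrBr /moment; congr (_ * (_ - _)).
  by rewrite coefXnM ltnNge leq_subr /= subKn // -ltnS.
rewrite coefXnM ltnNge ifF; last by have := ltn_ord k; lia.
by congr (_`_ _); have := ltn_ord k; lia.
Qed.

(** [homogenize N f] is X^N f((1 + X^2)/X) when f has degree at most N, so a factor X + a becomes X
    ((1 + X^2)/X + a). *)
Lemma homogenizeMXaddC N f a : (size f <= N.+1)%N ->
  homogenize N.+1 (('X + a%:P) * f) = (1 + a *: 'X + 'X^2) * homogenize N f.
Proof.
move=> size_f; rewrite /homogenize.
under eq_bigr do rewrite mulrDl coefD coefXM coefCM scalerDl.
rewrite big_split /= big_ord_recl /= scale0r add0r.
rewrite [X in _ + X]big_ord_recr /= nth_default // mulr0 scale0r addr0.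
rewrite mulr_sumr -big_split /=; apply: eq_bigr => k _.
rewrite subSS subSn ?exprS; last by rewrite -ltnS.
by rewrite -!mul_polyC polyCM; ring.
Qed.

Lemma homogenize_prod (s : seq C) :
  homogenize (size s) (\prod_(a <- s) ('X + a%:P)) =
  \prod_(a <- s) (1 + a *: 'X + 'X^2).
Proof.
elim: s => [|a s IH].
  by rewrite !big_nil /homogenize big_ord1 coef1 scale1r !expr0 mulr1.
rewrite !big_cons -IH homogenizeMXaddC //.
under eq_bigr do rewrite -[_%:P]opprK -polyCN.
by rewrite size_prod_XsubC.
Qed.

(** * The log-concavity operator on polynomials, and reversals *)

Definition lc_poly p : {poly C} :=
  \poly_(k < size p) (p`_k ^+ 2 - ('X * p)`_k * p`_k.+1).

(** The factor ['X] supplies p_(k-1), with value 0 at k = 0. Beyond the size of p both terms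
    vanish. *)
Lemma coef_lc_poly p k :
  (lc_poly p)`_k = p`_k ^+ 2 - ('X * p)`_k * p`_k.+1.
Proof.
rewrite coef_poly; case: ltnP => // le_pk.
rewrite [p`_k]nth_default // [p`_k.+1]nth_default ?leqW //.
by rewrite expr0n mulr0 subr0.
Qed.

Lemma size_lc_poly p : (size (lc_poly p) <= size p)%N.
Proof. exact: size_poly. Qed.

Lemma lc_polyZ c p : lc_poly (c *: p) = c ^+ 2 *: lc_poly p.
Proof.
apply/polyP => k; rewrite coefZ !coef_lc_poly -scalerAr !coefZ.
by move: (_`_k) (_`_k) (_`_k.+1) => u v r; ring.
Qed.

Definition reversal N p : {poly C} := \poly_(k < N.+1) p`_(N - k).

(** Against the reversal, the coefficient at N pairs each p_k with itself, and the one at N+2 pairs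
    coefficients whose indices differ by two. *)
Lemma coef_mul_reversal N p : (size p <= N.+1)%N ->
  (p * reversal N p)`_N - (p * reversal N p)`_N.+2 =
  \sum_(k < N.+1) (p`_k ^+ 2 - ('X * p)`_k * p`_k.+1).
Proof.
move=> size_p; rewrite sumrB !coefM; congr (_ - _).
  apply: eq_bigr => k _; rewrite coef_poly ltnS leq_subr subKn ?expr2 //.
  by rewrite -ltnS.
rewrite big_ord_recl big_ord_recr /= subn0 coef_poly ltnNge leqnSn mulr0 add0r.
rewrite [p`_(bump _ _)]nth_default ?mul0r ?addr0; last by rewrite leqW.
apply: eq_bigr => k _; rewrite coef_poly coefXM mulrC /bump leq0n add1n subSS.
have lt_kN := ltn_ord k; case: (k : nat) lt_kN => [|j] lt_jN /=.
  by rewrite subn0 ltnn.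
rewrite ifT; last by lia.
by congr (p`_ _ * _); lia.
Qed.

Lemma size_prod_1DscaleX (s : seq C) :
  (size (\prod_(b <- s) (1 + b *: 'X))%R <= (size s).+1)%N.
Proof.
elim: s => [|b s IH]; first by rewrite big_nil size_poly1.
rewrite big_cons mulrDl mul1r -scalerAl (leq_trans (size_polyD _ _)) //.
rewrite geq_max (leqW IH) (leq_trans (size_scale_leq _ _)) //.
by rewrite (leq_trans (size_polyMleq _ _)) // size_polyX.
Qed.

Lemma reversal_prod (s : seq C) :
  reversal (size s) (\prod_(b <- s) (1 + b *: 'X)) =
  \prod_(b <- s) ('X + b%:P).
Proof.
elim: s => [|b s IH].
  by rewrite !big_nil; apply/polyP => -[|k]; rewrite coef_poly !coef1.
rewrite !big_cons -IH [size (b :: s)]/=; have := size_prod_1DscaleX s.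
move: (\prod_(_ <- s) _) (size s) => p N size_p {IH}.
apply/polyP => k; rewrite mulrDl mul1r -scalerAl mulrDl coefD coefXM coefCM.
rewrite !coef_poly coefD coefZ coefXM ltnS.
case: k => [|k] /=; first by rewrite !subn0 nth_default.
rewrite !subSS ltnS; case: (leqP k N) => [le_kN|lt_Nk]; last first.
  by rewrite ifF ?mulr0 ?addr0 //; lia.
congr (_ + _ * _); rewrite ltnS subn_eq0 leqNgt subnS.
by case: ltnP.
Qed.

(** * Brändén's theorem: the operator preserves negative-rootedness *)

Lemma coef_prod_scale y (s : seq C) k :
  (\prod_(x <- s) (1 + (y * x) *: 'X))`_k =
  y ^+ k * (\prod_(x <- s) (1 + x *: 'X))`_k.
Proof.
elim: s k => [|x s IH] k.
  by rewrite !big_nil coef1; case: k => [|k]; rewrite ?expr0 ?mulr1 ?mulr0.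
rewrite !big_cons !mulrDl !mul1r -!scalerAl !coefD !coefZ !coefXM IH.
by case: k => [|k] /=; rewrite ?IH ?exprS; ring.
Qed.

(** In the partial order of C, both inequalities also say that the number is real. *)
Definition neg_rooted p := 0 < p`_0 /\ forall z, root p z -> z < 0.

(** Each factor X - r is rewritten as -r (1 - X/r); the constant term then collects all scalars. *)
Lemma neg_rooted_factor p : neg_rooted p ->
  exists2 s : seq C, {in s, forall x, 0 < x} &
    p = p`_0 *: \prod_(x <- s) (1 + x *: 'X).
Proof.
case=> p0_gt0 rootsp; have [rs pE] := closed_field_poly_normal p.
have p_neq0 : p != 0 by apply: contraTneq p0_gt0 => ->; rewrite coef0 ltxx.
have c_neq0 : lead_coef p != 0 by rewrite lead_coef_eq0.
have rs_lt0 r : r \in rs -> r < 0.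
  by move=> r_rs; apply: rootsp; rewrite pE rootZ // root_prod_XsubC.
exists [seq - r^-1 | r <- rs].
  by move=> _ /mapP[r /rs_lt0 r_lt0 ->]; rewrite oppr_gt0 invr_lt0.
rewrite big_map.
have prodE : \prod_(r <- rs) ('X - r%:P) =
    (\prod_(r <- rs) (- r)) *: \prod_(r <- rs) (1 + (- r^-1) *: 'X).
  rewrite -mul_polyC rmorph_prod -big_split /= !big_seq.
  apply: eq_bigr => r /rs_lt0/lt_eqF r_neq0.
  rewrite -mul_polyC mulrDr mulr1 mulrA -polyCM mulrNN divff ?r_neq0 //.
  by rewrite mul1r polyCN addrC.
have prod0 (s : seq C) : (\prod_(r <- s) (1 + (- r^-1) *: 'X : {poly C}))`_0 = 1.
  rewrite coef0_prod big1 // => r _.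
  by rewrite coefD coef1 coefZ coefX mulr0 addr0.
rewrite {2}pE prodE !coefZ prod0 mulr1 -scalerA -prodE.
exact: pE.
Qed.

Lemma neg_rooted_coef_ge0 p k : neg_rooted p -> 0 <= p`_k.
Proof.
move=> np; have [s s_gt0 ->] := neg_rooted_factor np; case: np => p0 _.
rewrite coefZ mulr_ge0 ?(ltW p0) // {p0 p}.
elim: s k s_gt0 => [|x s IH] k s_gt0; first by rewrite big_nil coef1 ler0n.
have {}IH j : 0 <= (\prod_(x <- s) (1 + x *: 'X))`_j.
  by apply: IH => y y_s; apply: s_gt0; rewrite in_cons y_s orbT.
rewrite big_cons mulrDl mul1r -scalerAl coefD coefZ coefXM addr_ge0 //.
rewrite mulr_ge0 ?(ltW (s_gt0 _ (mem_head _ _))) //.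
by case: eqP.
Qed.

Lemma lc_poly_neg_rooted p : neg_rooted p -> neg_rooted (lc_poly p).
Proof.
move=> np; have [s s_gt0 pE] := neg_rooted_factor np; have [p0_gt0 _] := np.
have lc0 : (lc_poly p)`_0 = p`_0 ^+ 2.
  by rewrite coef_lc_poly coefXM mul0r subr0.
split=> [|z root_z]; first by rewrite lc0 exprn_gt0.
apply: contraTT root_z => z_nlt0.
have [->|z_neq0] := eqVneq z 0.
  by rewrite /root horner_coef0 lc0 expf_neq0 // gt_eqF.
have [|y yE y_gt0] := @sqrt_Re_gt0 z.
  by rewrite le_eqVlt negb_or z_neq0.
have y_neq0 := Re_gt0_neq0 y_gt0.
rewrite pE lc_polyZ rootZ ?expf_neq0 ?gt_eqF //.
set q := \prod_(x <- s) _.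
(* Scaling the x_i by y multiplies the coefficient of index k by y^k, so that both products in the
   operator acquire y^(2k) = z^k. *)
pose bs := [seq y * x | x <- s].
pose P := \prod_(b <- bs) (1 + b *: 'X) : {poly C}.
have coefP k : P`_k = y ^+ k * q`_k.
  by rewrite /P big_map coef_prod_scale.
have lcE : (lc_poly q).[z] =
    (P * reversal (size bs) P)`_(size bs) - (P * reversal (size bs) P)`_(size bs).+2.
  rewrite coef_mul_reversal ?size_prod_1DscaleX // size_map.
  rewrite (@horner_coef_wide _ (size s).+1); last first.
    by rewrite (leq_trans (size_lc_poly _)) ?size_prod_1DscaleX.
  apply: eq_bigr => k _; rewrite coef_lc_poly !coefXM !coefP -yE exprAC.
  case: (k : nat) => [|j] /=; first by ring.
  by rewrite ![y ^+ _.+1]exprS; move: (y ^+ j) => u; ring.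
rewrite /root lcE reversal_prod -big_split /=.
(* Each factor is b (1 + (b + 1/b) X + X^2), the homogenization of X + a with a = b + 1/b, up to
   b. *)
have -> : \prod_(b <- bs) ((1 + b *: 'X) * ('X + b%:P)) =
    (\prod_(b <- bs) b) *: \prod_(a <- [seq b + b^-1 | b <- bs]) (1 + a *: 'X + 'X^2).
  rewrite [in RHS]big_map -mul_polyC rmorph_prod -big_split /= !big_seq.
  apply: eq_bigr => b /mapP[x /s_gt0 x_gt0 ->].
  have b_neq0 : y * x != 0 by rewrite mulf_neq0 // gt_eqF.
  move: (y * x) b_neq0 => {}b b_neq0; rewrite -!mul_polyC polyCD.
  have bV : b%:P * (b^-1)%:P = 1 :> {poly C} by rewrite -polyCM divff.
  have -> : b%:P * (1 + (b%:P + (b^-1)%:P) * 'X + 'X^2) =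
            b%:P + (b%:P * b%:P + b%:P * (b^-1)%:P) * 'X + b%:P * 'X^2 by ring.
  by rewrite bV; ring.
set as_ := [seq _ | b <- bs].
have size_as : size bs = size as_ by rewrite [RHS]size_map.
rewrite !coefZ -mulrBr mulf_neq0 //.
  rewrite prodf_seq_neq0; apply/allP => b /mapP[x /s_gt0 x_gt0 ->] /=.
  by rewrite mulf_neq0 // gt_eqF.
rewrite size_as -homogenize_prod -semicircle_homogenize.
have prodE : \prod_(a <- as_) ('X + a%:P) =
    \prod_(r <- [seq - a | a <- as_]) ('X - r%:P) :> {poly C}.
  by rewrite [RHS]big_map; apply: eq_bigr => a _; rewrite polyCN opprK.
rewrite prodE; apply: semicircle_hurwitz; first by rewrite size_prod_XsubC size_map.
move=> r; rewrite root_prod_XsubC => /mapP[a /mapP[b /mapP[x /s_gt0 x_gt0 ->] ->] ->].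
have Reb : 0 < 'Re (y * x).
  by rewrite ReMr ?ger0_real ?ltW // mulr_gt0.
by rewrite raddfN oppr_lt0 raddfD addr_gt0 // Re_inv_gt0.
Qed.

End NegativeRoots.

(** * Recurrence and negative roots of the generating polynomials *)

(* [g_poly t m] is the sum over d of g_{U_{m+2,d}}(t) X^(d-1) / t. *)
Definition g_poly (A : comNzRingType) (t : A) m : {poly A} :=
  \sum_(0 <= k < m.+1)
    (t ^+ k *+ 'C(m - k, k)) *: ('X^k * (1 + 'X) ^+ (m - k - k)).

Lemma g_poly_wide (A : comNzRingType) (t : A) m M : (m < M)%N ->
  g_poly t m = \sum_(0 <= k < M)
    (t ^+ k *+ 'C(m - k, k)) *: ('X^k * (1 + 'X) ^+ (m - k - k)).
Proof.
move=> lt_mM; rewrite [RHS](@big_cat_nat _ _ _ m.+1) //= [X in _ + X]big_nat.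
rewrite [X in _ + X]big1 ?addr0 // => k /andP[lt_mk _].
by rewrite bin_small ?mulr0n ?scale0r //; lia.
Qed.

Lemma g_poly_rec (A : comNzRingType) (t : A) m :
  g_poly t m.+2 = (1 + 'X) * g_poly t m.+1 + t *: 'X * g_poly t m.
Proof.
rewrite (@g_poly_wide _ _ m.+1 m.+3) // (@g_poly_wide _ _ m m.+2) //.
rewrite /g_poly ![\sum_(0 <= _ < m.+3) _]big_nat_recl // mulrDr -addrA.
congr (_ + _); first by rewrite !bin0 !expr0 !scale1r !mul1r !subn0 -exprS.
rewrite !mulr_sumr -big_split /=; apply: eq_big_nat => k /andP[_ lt_km].
rewrite !subSS -!mul_polyC !polyCMn !polyC_exp.
have [lt_mk|le_km] := ltnP m k.
  by rewrite !bin_small ?mulr0n ?mul0r ?mulr0 ?addr0 //; lia.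
(* Pascal's rule splits the term between g_(m+1) and g_m. *)
rewrite subSn // binS mulrnDr mulrDl; congr (_ + _); last first.
  by rewrite subSS [t%:P ^+ k.+1]exprS ['X^(k.+1)]exprS -!mulrnAr; ring.
have [lt_k|le_k] := ltnP (m - k)%N k.+1.
  by rewrite bin_small // mulr0n !mul0r mulr0.
rewrite subSS (_ : m - k - k = (m - k - k.+1).+1)%N ?[(1 + 'X) ^+ _.+1]exprS; last by lia.
by move: (_ ^+ _) (_ *+ _) => u v; ring.
Qed.

Lemma coef_g_poly (A : comNzRingType) (t : A) m e :
  (g_poly t m)`_e = \sum_(0 <= k < m.+1)
    t ^+ k *+ ('C(m - k, k) * (if (k <= e)%N then 'C(m - k - k, e - k) else 0)).
Proof.
rewrite coef_sum; apply: eq_bigr => k _.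
rewrite coefZ coefXnM ltnNge addrC exprD1n coef_sum mulrnA.
case: leqP => [le_ke|_] /=; last by rewrite mulr0n mulr0.
rewrite -[RHS]mulr_natr; congr (_ * _).
have [lt_e|le_e] := ltnP (m - k - k)%N (e - k)%N.
  rewrite bin_small // big1 // => i _; rewrite coefMn coefXn.
  by rewrite gtn_eqF ?mul0rn // (leq_ltn_trans _ lt_e) // -ltnS.
rewrite -ltnS in le_e; rewrite (bigD1 (Ordinal le_e)) //= coefMn coefXn eqxx.
rewrite big1 ?addr0 // => i neq_i; rewrite coefMn coefXn eq_sym.
by rewrite -[_ == (e - k)%N]/(i == Ordinal le_e) (negPf neq_i) mul0rn.
Qed.

Lemma g_poly_neg_rooted (C : numClosedFieldType) (t : C) m :
  0 < t -> neg_rooted (g_poly t m).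
Proof.
move=> t_gt0.
have Q0 : g_poly t 0 = 1.
  by rewrite /g_poly big_nat1 !expr0 mulr1 bin0 scale1r.
have Q1 : g_poly t 1 = 1 + 'X.
  rewrite /g_poly big_nat_recr //= big_nat1 !expr0 bin0 mulr1n mul1r scale1r.
  by rewrite subnn bin0n mulr0n scale0r addr0.
have g0 : (g_poly t m).[0] = 1.
  suff: (g_poly t m).[0] = 1 /\ (g_poly t m.+1).[0] = 1 by case.
  elim: m => [|m [IH1 IH2]]; first by rewrite Q0 Q1 !hornerE.
  rewrite IH2 g_poly_rec hornerD !hornerM hornerZ hornerD IH2 -polyC1 hornerC.
  by rewrite hornerX mulr0 mul0r !addr0 mulr1.
split=> [|z]; first by rewrite -horner_coef0 g0 ltr01.
apply: contraTT => z_nlt0.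
have [->|z_neq0] := eqVneq z 0; first by rewrite /root g0 oner_neq0.
have [|y yE y_gt0] := @sqrt_Re_gt0 _ z; first by rewrite le_eqVlt negb_or z_neq0.
have y_neq0 := Re_gt0_neq0 y_gt0.
pose g n := (g_poly t n).[z].
suff step n : g n != 0 /\ 0 < 'Re (g n.+1 / (y * g n)) by case: (step m).
elim: n => [|n [gn_neq0 Re_q]].
  rewrite /g Q0 Q1 !hornerE oner_neq0; split=> //.
  have -> : (1 + z) / y = y^-1 + y by rewrite -yE; field.
  by rewrite raddfD addr_gt0 // Re_inv_gt0.
have gS_neq0 : g n.+1 != 0.
  by apply: contraTneq Re_q => ->; rewrite mul0r raddf0 ltxx.
split=> //.
(* For the ratio q of the induction, the recurrence reads y + 1/y + t/q, a sum of numbers of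
   positive real part. *)
have -> : g n.+2 / (y * g n.+1) = y^-1 + y + t * (g n.+1 / (y * g n))^-1.
  rewrite /g g_poly_rec hornerD !hornerM hornerZ hornerD -polyC1 hornerC hornerX.
  by rewrite -/(g n) -/(g n.+1) -yE; field; rewrite y_neq0 gS_neq0 gn_neq0.
rewrite !raddfD /= !addr_gt0 ?Re_inv_gt0 //.
by rewrite ReMl ?gtr0_real // mulr_gt0 ?Re_inv_gt0.
Qed.

(** * From the generating polynomial to the sequence *)

Lemma g_coef_out m e k : (m < e + k)%N ->
  ('C(m - k, k) * (if (k <= e)%N then 'C(m - k - k, e - k) else 0) = 0)%N.
Proof.
move=> lt_m; case: leqP => [le_ke|_]; last by rewrite muln0.
have [lt_k|le_k] := ltnP (m - k)%N k; first by rewrite bin_small.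
by rewrite [X in (_ * X)%N]bin_small ?muln0 //; lia.
Qed.

(** With k = i-1, the multinomial (m-k)!/((e-k)! (m-e-k)! k!) factors as C(m-k,k) C(m-2k,e-k). *)
Lemma gU_coef (R : realType) (t : R) m e : (e <= m)%N ->
  gU m.+2 e.+1 t = t * (g_poly t m)`_e.
Proof.
move=> le_em; rewrite coef_g_poly /gU big_add1 /=.
have -> : minn e.+1 (m.+2 - e.+1) = (minn e (m - e)).+1 by lia.
(* The terms with k above min(e, m-e) vanish. *)
rewrite (@big_cat_nat _ _ _ (minn e (m - e)).+1 0 m.+1) //=; last by lia.
rewrite [X in _ = _ * (_ + X)]big_nat [X in _ = _ * (_ + X)]big1 ?addr0.
  rewrite mulr_sumr; apply: eq_big_nat => k /andP[_ le_k].
  have le_ke : (k <= e)%N by lia.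
  have -> : (m.+2 - k.+1 - 1 = m - k)%N by lia.
  have -> : (e.+1 - k.+1 = e - k)%N by lia.
  have -> : (m.+2 - e.+1 - k.+1 = m - e - k)%N by lia.
  have h1 : (k <= m - k)%N by lia.
  have h2 : (e - k <= m - k - k)%N by lia.
  rewrite subn1 /= le_ke -(bin_fact h1) -(bin_fact h2).
  have -> : (m - k - k - (e - k) = m - e - k)%N by lia.
  rewrite -[t ^+ k *+ _]mulr_natr !natrM exprS.
  have fact_neq0 i : i`!%:R != 0 :> R by rewrite pnatr_eq0 -lt0n fact_gt0.
  by field; rewrite !fact_neq0.
move=> k /andP[lt_k _]; have [lt_ek|le_ke] := ltnP e k.
  by rewrite muln0 mulr0n.
by have := @g_coef_out m e k; rewrite le_ke => ->; rewrite ?mulr0n //; lia.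
Qed.

(** One application of the operator replaces p by [lc_poly p], which stays negative-rooted. The
    shift by one reflects sequences that start at index 1. *)
Lemma iter_logconc_op (R : realType) (a : int -> R) (p : {poly R[i]}) j :
    neg_rooted p ->
    (forall k, (a k)%:C%C = if k is Posz d.+1 then p`_d else 0) ->
  forall k, 0 <= iter j (@logconc_op R) a k.
Proof.
elim: j a p => [|j IH] a p np aE k.
  rewrite -lecR aE; case: k => [[|d]|d] //; exact: neg_rooted_coef_ge0.
rewrite iterSr; apply: IH (lc_poly_neg_rooted np) _ k => k.
rewrite /logconc_op rmorphB rmorphXn rmorphM /=; case: k => [[|d]|d].
- by rewrite !aE expr0n mul0r subr0.
- have -> : Posz d.+1 - 1 = Posz d by rewrite -addn1 PoszD addrK.
  have -> : Posz d.+1 + 1 = Posz d.+2 by rewrite -[in RHS]addn1 PoszD.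
  by rewrite !aE coef_lc_poly coefXM; case: d.
- have -> : Negz d - 1 = Negz d.+1 by rewrite !NegzE -opprD -PoszD addn1.
  by rewrite !aE expr0n mul0r subr0.
Qed.

Theorem theorem1p3 (R : realType) (t : R) (ht : 0 < t) (n : nat)
    (hn : (4 <= n)%N) :
  infinitely_log_concave (zero_ext 1 (n - 1) (fun d : nat => gU n d t)).
Proof.
move=> j _; case: n hn => [|[|m]] // _.
pose p : {poly R[i]} := t%:C%C *: g_poly t%:C%C m.
have tC_gt0 : 0 < t%:C%C :> R[i] by rewrite ltcR.
apply: (@iter_logconc_op R _ p).
  have [Q0 rQ] := g_poly_neg_rooted m tC_gt0.
  split=> [|z]; first by rewrite coefZ mulr_gt0.
  by rewrite rootZ ?gt_eqF //; exact: rQ.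
case=> [[|e]|e] //=; rewrite coefZ.
rewrite subn1 /= ltnS; case: leqP => [le_em|lt_me].
  rewrite gU_coef // rmorphM; congr (_ * _).
  rewrite !coef_g_poly rmorph_sum; apply: eq_bigr => k _ /=.
  by rewrite rmorphMn rmorphXn.
(* Past degree m the coefficients vanish, in agreement with the extension by zeros. *)
rewrite coef_g_poly big1 ?mulr0 // => k _.
by rewrite g_coef_out ?mulr0n // ltn_addr.
Qed.
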